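(* Consider an instance of the nested $p$-center problem with the minimizing the maximum relative regret objective and the mixed-integer linear program (nPCR1) given in the context. For a given $h\in\mathcal H$, let $LB^h\ge 0$ be a valid lower bound on the optimal objective function value of the $p$-center problem for $p=p^h$. Then, for every $i\in\mathcal I$ and $j\in\mathcal J$, the inequality $$z^h\ \ge\ \max\{LB^h,d_{ij}\}-\sum_{j'\in\mathcal J:\,d_{ij'}<d_{ij}}\bigl(\max\{LB^h,d_{ij}\}-\max\{LB^h,d_{ij'}\}\bigr)\,y_{j'}^h$$ is valid for (nPCR1), i.e., every feasible solution of (nPCR1) fulfills it.
   Context: Instance: $\mathcal I$ is a finite nonempty set of customer demand points, $\mathcal J$ a finite nonempty set of potential facility locations, with distances $d_{ij}\ge 0$. The time horizon is $\mathcal H=\{1,\dots,H\}$, and $p^1,\dots,p^H$ are positive integers with $p^h\le p^{h+1}$ for $h=1,\dots,H-1$ and $p^H\le|\mathcal J|$. The $p$-center problem asks for $S\subseteq\mathcal J$ with $|S|=p$ minimizing $\max_{i\in\mathcal I}\min_{j\in S}d_{ij}$. Let $d^{h*}$ be its optimal value for $p=p^h$, assumed positive for all $h\in\mathcal H$. (nPCR1) is the mixed-integer linear program: minimize $w$ subject to - $\sum_{j\in\mathcal J}y_j^h=p^h$ for all $h\in\mathcal H$; - $z^h\ge d_{ij}-\sum_{j'\in\mathcal J:\,d_{ij'}<d_{ij}}(d_{ij}-d_{ij'})\,y_{j'}^h$ for all $i\in\mathcal I$, $j\in\mathcal J$, $h\in\mathcal H$; - $w\ge\frac{z^h-d^{h*}}{d^{h*}}$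 for all $h\in\mathcal H$; - $y_j^h\ge y_j^{h-1}$ for all $j\in\mathcal J$, $h\in\mathcal H\setminus\{1\}$; - $y_j^h\in\{0,1\}$, $z^h\in\mathbb R_{\ge0}$, $w\in\mathbb R_{\ge0}$ for all $j\in\mathcal J$, $h\in\mathcal H$. *)

(* Defs.v *)
From HB Require Import structures.
From mathcomp Require Import all_boot all_order all_algebra.

Set Implicit Arguments.
Unset Strict Implicit.
Unset Printing Implicit Defensive.

Import Order.TTheory GRing.Theory Num.Theory.
Local Open Scope ring_scope.

(* The minimum and maximum of F over a nonempty A; both are 0 when A is empty,
   a case excluded by [setminP] and [setmaxP]. *)
Definition setmin (R : realFieldType) (T : finType) (A : {set T}) (F : T -> R)
    : R :=
  if [pick x in A] is Some x0 then F [arg min_(x < x0 in A) F x]%O else 0.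

Definition setmax (R : realFieldType) (T : finType) (A : {set T}) (F : T -> R)
    : R :=
  if [pick x in A] is Some x0 then F [arg max_(x > x0 in A) F x]%O else 0.

Lemma setminP (R : realFieldType) (T : finType) (A : {set T}) (F : T -> R) :
  A != set0 ->
  (exists2 x, x \in A & setmin A F = F x) /\
  (forall x, x \in A -> setmin A F <= F x).
Proof.
rewrite /setmin => /set0Pn [x Ax]; case: pickP => [x0 Ax0|/(_ x)]; last first.
  by rewrite Ax.
by case: arg_minP => // y Ay le_y; split => //; exists y.
Qed.

Lemma setmaxP (R : realFieldType) (T : finType) (A : {set T}) (F : T -> R) :
  A != set0 ->
  (exists2 x, x \in A & setmax A F = F x) /\
  (forall x, x \in A -> F x <= setmax A F).
Proof.
rewrite /setmax => /set0Pn [x Ax]; case: pickP => [x0 Ax0|/(_ x)]; last first.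
  by rewrite Ax.
by case: arg_maxP => // y Ay le_y; split => //; exists y.
Qed.

Definition pcenter_cost (R : realFieldType) (I J : finType) (d : I -> J -> R)
    (S : {set J}) : R :=
  setmax [set: I] (fun i => setmin S (fun j => d i j)).

Definition pcenter_opt (R : realFieldType) (I J : finType) (d : I -> J -> R)
    (p : nat) : R :=
  setmin [set S : {set J} | #|S| == p] (pcenter_cost d).

(* Time periods 1, ..., H are represented by the elements 0, ..., H - 1 of
   'I_H.  The objective, to be minimized, is w. *)
Record nPCR1_feasible (R : realFieldType) (I J : finType) (d : I -> J -> R)
    (H : nat) (p : 'I_H -> nat)
    (y : 'I_H -> J -> R) (z : 'I_H -> R) (w : R) : Prop := NPCR1Feasible {
  nPCR1_card : forall h, \sum_j y h j = (p h)%:R;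
  nPCR1_dist : forall i j h,
    z h >= d i j - \sum_(j' | d i j' < d i j) (d i j - d i j') * y h j';
  nPCR1_regret : forall h,
    w >= (z h - pcenter_opt d (p h)) / pcenter_opt d (p h);
  nPCR1_nested : forall (h h' : 'I_H) j, h = h'.+1 :> nat -> y h j >= y h' j;
  nPCR1_binary : forall h j, y h j = 0 \/ y h j = 1;
  nPCR1_z_ge0 : forall h, 0 <= z h;
  nPCR1_w_ge0 : 0 <= w
}.

(* Main.v *)
Require Import Defs.
From HB Require Import structures.
From mathcomp Require Import all_boot all_order all_algebra.

Set Implicit Arguments.
Unset Strict Implicit.
Unset Printing Implicit Defensive.

Import Order.TTheory GRing.Theory Num.Theory.
Local Open Scope ring_scope.

(** The binary values of period h select a set S of exactly p^h facilities.
    For a customer i, the distance constraint indexed by a facility m of S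
    nearest to i has only closed facilities in its sum, so it reads
    z^h >= d_im: hence z^h bounds the service distance of every customer
    ([setmin_open_le]).  Consequently z^h bounds the p-center cost of S, thus
    the optimum, and thus the given lower bound LB ([pcenter_opt_le]).

    So max (LB, d_im) <= z^h, and the strengthened inequality follows by
    showing that its right-hand side is at most max (LB, d_im).  All terms of
    its sum are nonnegative.  If d_im < d_ij, then m contributes the term
    max (LB, d_ij) - max (LB, d_im), and keeping this term alone suffices;
    otherwise d_ij <= d_im and the whole sum can be dropped. *)

Definition open_facilities (R : realFieldType) (J : finType) (y : J -> R)
    : {set J} := [set j | y j == 1].

Lemma card_open (R : realFieldType) (J : finType) (y : J -> R) (n : nat) :
  (forall j, y j = 0 \/ y j = 1) -> \sum_j y j = n%:R ->
  #|open_facilities y| = n.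
Proof.
move=> y01 sum_y; apply/eqP; rewrite -(eqr_nat R) -sum_y -sum1_card natr_sum.
rewrite big_mkcond /=; apply/eqP/eq_bigr => j _; rewrite inE.
by case: (y01 j) => ->; rewrite ?eqxx // eq_sym oner_eq0.
Qed.

(** In the distance constraint indexed by a nearest open facility, every
    facility of the sum is strictly nearer, hence closed, so the constraint
    bounds the service distance itself. *)
Lemma setmin_open_le (R : realFieldType) (J : finType) (d y : J -> R) (z : R) :
  (forall j, y j = 0 \/ y j = 1) -> open_facilities y != set0 ->
  (forall j, z >= d j - \sum_(j' | d j' < d j) (d j - d j') * y j') ->
  setmin (open_facilities y) d <= z.
Proof.
move=> y01 /(setminP d) [[m _ ->] m_min] dist_le.
have := dist_le m; rewrite big1 ?subr0 // => j lt_jm.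
case: (y01 j) => [-> | yj1]; first by rewrite mulr0.
have : d m <= d j by rewrite m_min // inE yj1.
by rewrite leNgt lt_jm.
Qed.

Lemma pcenter_opt_le (R : realFieldType) (I J : finType) (d : I -> J -> R)
    (S : {set J}) (z : R) :
  (0 < #|I|)%N -> (forall i, setmin S (d i) <= z) ->
  pcenter_opt d #|S| <= z.
Proof.
move=> I_gt0 le_z; set F := [set S' : {set J} | #|S'| == #|S| ].
have FS : S \in F by rewrite inE.
have F0 : F != set0 by apply/set0Pn; exists S.
apply: le_trans ((setminP (pcenter_cost d) F0).2 S FS) _.
have I0 : [set: I] != set0 by rewrite -card_gt0 cardsT.
rewrite /pcenter_cost.
by have [[i _ ->] _] := setmaxP (fun i => setmin S (fun j => d i j)) I0.
Qed.

(** Taking the maximum with LB is weakly monotone, so every term of the sum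
    is nonnegative.  With m a nearest open facility, the right-hand side is
    then at most max (LB, d m), both parts of which are at most z. *)
Lemma strengthened_dist_le (R : realFieldType) (J : finType) (d y : J -> R)
    (LB z : R) (j : J) :
  (forall j, y j = 0 \/ y j = 1) -> open_facilities y != set0 ->
  setmin (open_facilities y) d <= z -> LB <= z ->
  z >= Num.max LB (d j) -
       \sum_(j' | d j' < d j) (Num.max LB (d j) - Num.max LB (d j')) * y j'.
Proof.
move=> y01 /(setminP d) [[m open_m ->] _] dm_le LB_le.
have ym1 : y m = 1 by move: open_m; rewrite inE => /eqP.
have max_mono a b : a <= b -> Num.max LB a <= Num.max LB b.
  by move=> le_ab; rewrite ge_max !le_max lexx le_ab orbT.
have term_ge0 k :
    d k < d j -> 0 <= (Num.max LB (d j) - Num.max LB (d k)) * y k.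
  move=> /ltW lt_kj; rewrite mulr_ge0 ?subr_ge0 ?max_mono //.
  by case: (y01 k) => ->.
apply: (@le_trans _ _ (Num.max LB (d m))); last by rewrite ge_max LB_le.
rewrite lerBlDr; case: (ltP (d m) (d j)) => [lt_mj | le_jm].
  rewrite (bigD1 m) //= ym1 mulr1 addrA [_ + (_ - _)]addrC subrK lerDl.
  by apply: sumr_ge0 => k /andP[/term_ge0].
by apply: le_trans (max_mono _ _ le_jm) _; rewrite lerDl sumr_ge0.
Qed.

Theorem proposition16 (R : realFieldType) (I J : finType)
  (I_gt0 : (0 < #|I|)%N) (J_gt0 : (0 < #|J|)%N)
  (d : I -> J -> R) (d_ge0 : forall i j, 0 <= d i j)
  (H : nat) (p : 'I_H -> nat)
  (p_gt0 : forall h, (0 < p h)%N)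
  (p_mono : forall h h' : 'I_H, h = h'.+1 :> nat -> (p h' <= p h)%N)
  (p_le : forall h : 'I_H, h.+1 = H -> (p h <= #|J|)%N)
  (opt_gt0 : forall h, 0 < pcenter_opt d (p h))
  (h : 'I_H) (LB : R) (LB_ge0 : 0 <= LB) (LB_le : LB <= pcenter_opt d (p h)) :
  forall (i : I) (j : J) (y : 'I_H -> J -> R) (z : 'I_H -> R) (w : R),
    nPCR1_feasible d p y z w ->
    z h >= Num.max LB (d i j)
           - \sum_(j' | d i j' < d i j)
               (Num.max LB (d i j) - Num.max LB (d i j')) * y h j'.
Proof.
move=> i j y z w [card_y dist_y _ _ bin_y _ _].
have card_S := card_open (bin_y h) (card_y h).
have S_neq0 : open_facilities (y h) != set0 by rewrite -card_gt0 card_S.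
have service_le i' : setmin (open_facilities (y h)) (d i') <= z h.
  by apply: setmin_open_le => // j'; apply: dist_y.
apply: strengthened_dist_le => //; apply: le_trans LB_le _.
by rewrite -card_S; apply: pcenter_opt_le.
Qed.
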